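(* Let $n$ be a nonnegative integer. The number of partitions $f$ of $n$ in one color (parts in $\mathbb Z_{>0}$) such that each part appears at most twice (i.e. $f_a\le 2$ for all $a$) equals the number of colored partitions $f$ of $n$ in three colors, with parts in $A=\{r,\underline r,\underline{\underline r}\mid r\in\mathbb Z_{>0}\}$, such that each part appears at most once (i.e. $f_a\le 1$ for all $a\in A$) and such that all the following conditions hold: (1) $f_{\underline{\underline r}}>0$ implies $|\underline{\underline r}|\equiv\pm1\pmod 3$; (2) the parts $r$ and $\underline r$ occurring in $f$ satisfy $|r|>1$, $|\underline r|>1$, and the parts $\underline{\underline r}$ occurring in $f$ satisfy $|\underline{\underline r}|\ne 2$; (3) $f_a+f_b\le 1$ for all $a,b\in A$, $a\neq b$, with $\bigl||a|-|b|\bigr|\le 1$; (4) for all $i\in\mathbb N$: $$f_{3i+2}+f_{3i+3}+f_{\underline{3i+4}}+f_{3i+5}\le 1,$$ $$f_{\underline{3i+2}}+f_{\underline{3i+3}}+f_{\underline{\underline{3i+4}}}+f_{\underline{3i+5}}\le 1,$$ $$f_{\underline{\underline{3i+2}}}+f_{\underline{3i+3}}+f_{3i+4}+f_{\underline{\underline{3i+5}}}\le 1,$$ $$f_{3i+1}+f_{\underline{3i+2}}+f_{3i+3}+f_{3i+4}\le 1,$$ $$f_{\underline{3i+1}}+f_{\underline{\underline{3i+2}}}+f_{\underline{3i+3}}+f_{\underline{3i+4}}\le 1,$$ $$f_{\underline{\underline{3i+1}}}+f_{3i+2}+f_{\underline{3i+3}}+f_{\underline{\underline{3i+4}}}\le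 1;$$ (5) for all $i\in\mathbb N$: $$f_{\underline{3i+1}}+f_{3i+3}+f_{\underline{\underline{3i+5}}}\le 2,\qquad f_{\underline{\underline{3i+1}}}+f_{3i+3}+f_{\underline{3i+5}}\le 2.$$
   Context: $\mathbb N=\{0,1,2,\dots\}$. The set $A=\{r,\underline r,\underline{\underline r}\mid r\in\mathbb Z_{>0}\}$ is the disjoint union of three copies of $\mathbb Z_{>0}$ (three colors: plain, underlined, doubly underlined); the degree is $|r|=|\underline r|=|\underline{\underline r}|=r$. A colored partition with parts in $A$ is a map $f:A\to\mathbb N$, $a\mapsto f_a$, with $f_a=0$ for all but finitely many $a$; $a$ is a part of $f$ (occurs in $f$) if $f_a>0$. Its degree is $|f|=\sum_{a\in A}|a|f_a$, and $f$ is called a colored partition of $|f|$. One-color partitions are defined in the same way with $\mathbb Z_{>0}$ in place of $A$. *)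

(* Defs.v *)
From HB Require Import structures.
From mathcomp Require Import all_boot all_order finmap.
From mathcomp Require Import ssralg ssrnum ssrint.
From mathcomp Require Import boolp classical_sets functions cardinality.

Set Implicit Arguments.
Unset Strict Implicit.
Unset Printing Implicit Defensive.

Local Open Scope nat_scope.

Definition zpos : Type := {r : nat | 0 < r}.

Variant color : Type := Plain | Underlined | DoublyUnderlined.

Definition color_code (c : color) : 'I_3 :=
  match c with
  | Plain => inord 0 | Underlined => inord 1 | DoublyUnderlined => inord 2
  end.

Definition color_decode (i : 'I_3) : color :=
  match val i with
  | 0 => Plain | 1 => Underlined | _ => DoublyUnderlined
  end.

Fact color_codeK : cancel color_code color_decode.
Proof. by case; rewrite /color_decode /= inordK. Qed.

HB.instance Definition _ := Finite.copy color (can_type color_codeK).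

(* The set A: [(Plain, r)] is r, [(Underlined, r)] is r underlined and
   [(DoublyUnderlined, r)] is r doubly underlined. *)
Definition part : Type := (color * zpos)%type.

Definition degree (a : part) : nat := val a.2.

Definition colored_partition : Type := {fsfun part -> nat with 0}.

Definition one_color_partition : Type := {fsfun zpos -> nat with 0}.

Definition weight (T : choiceType) (deg : T -> nat)
    (f : {fsfun T -> nat with 0}) : nat :=
  (\sum_(a <- finsupp f) deg a * f a)%N.

Definition one_color_partitions_of (n : nat) : set one_color_partition :=
  [set f | weight (fun r : zpos => val r) f = n]%classic.

Definition colored_partitions_of (n : nat) : set colored_partition :=
  [set f | weight degree f = n]%classic.

(* The multiplicity in f of the part of colour c and degree r, for r given as a
   plain natural number; the value at r = 0 is a default, since 0 is not a
   part. *)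
Definition mult (f : colored_partition) (c : color) (r : nat) : nat :=
  if insub r is Some p then f ((c, p) : part) else 0.

Lemma multE (f : colored_partition) (a : part) :
  mult f a.1 (degree a) = f a.
Proof. by case: a => c p; rewrite /mult /degree /= valK. Qed.

(* -1 is represented by 2 modulo 3. *)
Definition congruence_condition (f : colored_partition) : Prop :=
  forall r : zpos, 0 < f (DoublyUnderlined, r) ->
    val r = 1 %[mod 3] \/ val r = 2 %[mod 3].

Definition initial_condition (f : colored_partition) : Prop :=
  [/\ forall r : zpos, 0 < f (Plain, r) -> 1 < val r,
      forall r : zpos, 0 < f (Underlined, r) -> 1 < val r
    & forall r : zpos, 0 < f (DoublyUnderlined, r) -> val r <> 2].

(* The degrees are compared by [distn], so the subtraction is not truncated. *)
Definition difference_condition (f : colored_partition) : Prop :=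
  forall a b : part, a <> b -> `|degree a - degree b| <= 1 -> f a + f b <= 1.

Definition four_term_condition (f : colored_partition) : Prop :=
  let p := mult f Plain in
  let u := mult f Underlined in
  let d := mult f DoublyUnderlined in
  forall i : nat,
  [/\ p (3 * i + 2) + p (3 * i + 3) + u (3 * i + 4) + p (3 * i + 5) <= 1,
      u (3 * i + 2) + u (3 * i + 3) + d (3 * i + 4) + u (3 * i + 5) <= 1
    & d (3 * i + 2) + u (3 * i + 3) + p (3 * i + 4) + d (3 * i + 5) <= 1] /\
  [/\ p (3 * i + 1) + u (3 * i + 2) + p (3 * i + 3) + p (3 * i + 4) <= 1,
      u (3 * i + 1) + d (3 * i + 2) + u (3 * i + 3) + u (3 * i + 4) <= 1
    & d (3 * i + 1) + p (3 * i + 2) + u (3 * i + 3) + d (3 * i + 4) <= 1].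

Definition three_term_condition (f : colored_partition) : Prop :=
  let p := mult f Plain in
  let u := mult f Underlined in
  let d := mult f DoublyUnderlined in
  forall i : nat,
    u (3 * i + 1) + p (3 * i + 3) + d (3 * i + 5) <= 2 /\
    d (3 * i + 1) + p (3 * i + 3) + u (3 * i + 5) <= 2.

Section Finiteness.
Local Open Scope classical_set_scope.

Lemma finite_weight (T : choiceType) (deg : T -> nat) (n : nat) :
    (forall a, 0 < deg a) -> finite_set [set a | deg a <= n] ->
  finite_set [set f : {fsfun T -> nat with 0} | weight deg f = n].
Proof.
move=> deg_gt0 finD; set S := [set f | _].
pose D := fset_set [set a | deg a <= n].
have bnd f a : S f -> deg a * f a <= n.
  move=> <-; have [aS | aS] := boolP (a \in finsupp f); last first.
    by rewrite fsfun_dflt // muln0.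
  by rewrite /weight (big_fsetD1 a) //= leq_addr.
have supp f a : S f -> a \notin D -> f a = 0.
  move=> Sf; rewrite in_fset_set // => /negP aD.
  case E: (f a) => [//|k]; case: aD; rewrite inE /=.
  by apply: leq_trans (bnd f a Sf); rewrite E mulnS leq_addr.
pose code (f : {fsfun T -> nat with 0}) : {ffun D -> 'I_n.+1} :=
  [ffun x => inord (f (val x))].
have code_inj : {in S &, injective code}; last first.
  by rewrite -(eq_finite_set (inj_card_eq code_inj)); exact: finite_finset.
move=> f g; rewrite !inE => Sf Sg fg; apply/fsfunP => a.
have [aD | aD] := boolP (a \in D); last by rewrite !supp.
have le_n h : S h -> h a < n.+1.
  by move=> Sh; rewrite ltnS; apply: leq_trans (bnd h a Sh); rewrite leq_pmull.
have := congr1 (fun h : {ffun D -> 'I_n.+1} => val (h [` aD]%fset)) fg.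
by rewrite !ffunE /= !inordK // le_n.
Qed.

Lemma finite_zpos_le (n : nat) : finite_set [set r : zpos | val r <= n].
Proof.
pose one : zpos := Sub 1 isT.
apply: (@sub_finite_set _ _ ((fun k => insubd one k) @` `I_n.+1)).
  by move=> r /= rn; exists (val r); rewrite ?valKd.
by apply: finite_image; exact: finite_II.
Qed.

Lemma finite_one_color_partitions_of (n : nat) :
  finite_set (one_color_partitions_of n).
Proof. by apply: finite_weight; [exact: valP | exact: finite_zpos_le]. Qed.

Lemma finite_colored_partitions_of (n : nat) :
  finite_set (colored_partitions_of n).
Proof.
apply: finite_weight => [a|]; first exact: valP.
apply: (@sub_finite_set _ _ (setT `*` [set r : zpos | val r <= n])).
  by move=> [c r] /= rn.
by apply: finite_setX; [exact: finite_finset | exact: finite_zpos_le].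
Qed.

End Finiteness.

(* Main.v *)
Require Import Defs.
From mathcomp Require Import all_boot finmap classical_sets cardinality.
From mathcomp Require Import all_algebra qpoly ring zify.

(** Both sides are counted by generating functions.  The one-colour side is the
    product over r of 1 + q^r + q^(2r), that is, (q^3;q^3)_oo / (q;q)_oo.

    An admissible coloured partition has at most one part in each degree, no two
    parts in adjacent degrees, and every other restriction reaches back at most
    four degrees.  It is therefore a word, with one letter (no part, or the colour
    of the part) for each degree, accepted by an automaton that remembers a window
    of four letters.  Let z(j) be the generating function of what may follow a
    part of degree j - 1.  Three observations make z computable.

    - If j - 1 is not divisible by 3, then z(j) does not depend on the colour of
      the part ([colour_ruleP]).  For parts of degree 1 modulo 3 this is the
      purpose of the three-term condition: a plain part of degree divisible by 3
      has one more possible successor than the underlined one, and the condition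
      removes it exactly when the plain part comes two degrees after an
      underlined or doubly underlined part.  If j - 1 is divisible by 3, let z(j)
      refer to an underlined part.

    - The continuations of a part of degree j - 1 that start in degree j + 3 or
      later are subject to no restriction from that part.  Eliminating them
      between z(j) and z(j+1) leaves a scalar linear recurrence
      ([recurrence_at]).  Its solution is determined by z(j) tending to 1, and it
      is ([closed_form])
        z(j) = sum_m q^(m^2 + j m) c_m prod_(l > m + (j + 2) / 3) (1 - q^(3 l)),
      where c_m = (q^3;q^3)_m / (q;q)_m^2 and the division by 3 is rounded down.
      The recurrence for the sum follows term by term from
        c_(m+1) (1 - q^(m+1)) = c_m (1 + q^(m+1) + q^(2 m + 2)).

    - The initial condition says that a doubly underlined part of degree -1
      precedes the partition, so that z(0) is the generating function of all
      admissible partitions.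

    At j = 0 the factors involving q^3 merge into the whole product (q^3;q^3)_oo:
      z(0) = (q^3;q^3)_oo * sum_m q^(m^2) / (q;q)_m^2,
    and the sum is 1 / (q;q)_oo by Durfee's identity ([durfee]).

    Only the coefficient of q^n matters, so the power series live in a
    commutative ring in which q^M = 0; at the end q is the class of X in
    Z[X] / (X^(n+1)). *)

Set Implicit Arguments.
Unset Strict Implicit.
Unset Printing Implicit Defensive.

Local Open Scope nat_scope.
Import GRing.Theory.

(** * Truncated q-series *)

Section TruncatedSeries.
Local Open Scope ring_scope.

Variables (R : comNzRingType) (q : R) (M : nat).
Hypothesis qM0 : q ^+ M = 0.

Lemma expq_ge k : (M <= k)%N -> q ^+ k = 0.
Proof. by move=> leMk; rewrite -(subnKC leMk) exprD qM0 mul0r. Qed.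

Lemma trunc_gt0 : (0 < M)%N.
Proof. by case: M qM0 => // /eqP; rewrite expr0 oner_eq0. Qed.

Lemma sum_shift (f : nat -> R) : f 0%N = 0 -> f M = 0 ->
  \sum_(m < M) f m = \sum_(m < M) f m.+1.
Proof.
move=> f0 fM; have := @big_ord_recr R 0 +%R M (fun i => f i).
by rewrite big_ord_recl /= f0 fM add0r addr0 => <-.
Qed.

(** Series indexed by a degree j are trivial from j = M on, hence are compared by
    induction from large j to small j. *)
Lemma downward_ind (P : nat -> Prop) :
  (forall j, (M <= j)%N -> P j) ->
  (forall j, (forall i, (j < i)%N -> P i) -> P j) ->
  forall j, P j.
Proof.
move=> big step j; move: {2}(M - j)%N (leqnn (M - j)) => d.
elim: d j => [|d IH] j led; first by apply: big; rewrite -subn_eq0 -leqn0.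
by apply: step => i ltji; have [/big//|ltiM] := leqP M i; apply: IH; lia.
Qed.

Definition geom (j : nat) : R := \sum_(i < M) (q ^+ j) ^+ i.

Lemma geomK j : (0 < j)%N -> (1 - q ^+ j) * geom j = 1.
Proof.
move=> j0; rewrite -opprB mulNr -subrX1 -exprM expq_ge ?sub0r ?opprK //.
by rewrite leq_pmull.
Qed.

(** 1 / (q;q)_m *)
Definition poch_inv (m : nat) : R := \prod_(i < m) geom i.+1.

Lemma poch_invS m : (1 - q ^+ m.+1) * poch_inv m.+1 = poch_inv m.
Proof. by rewrite /poch_inv big_ord_recr /= mulrCA geomK ?mulr1. Qed.

(** (q^(n+1);q)_oo: the omitted factors are equal to 1. *)
Definition poch_tail (n : nat) : R := \prod_(n <= i < M) (1 - q ^+ i.+1).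

Lemma poch_tail_ge n : (M <= n)%N -> poch_tail n = 1.
Proof. by move=> leMn; rewrite /poch_tail big_geq. Qed.

Lemma poch_tailS n : poch_tail n = (1 - q ^+ n.+1) * poch_tail n.+1.
Proof.
rewrite /poch_tail; have [ltnM|leMn] := ltnP n M; first by rewrite big_ltn.
by rewrite !big_geq ?expq_ge ?subr0 ?mulr1 ?(leqW leMn).
Qed.

Lemma poch_inv_tail m : poch_inv m * poch_tail 0 = poch_tail m.
Proof.
elim: m => [|m IH]; first by rewrite /poch_inv big_ord0 mul1r.
rewrite /poch_inv big_ord_recr /= mulrAC -/(poch_inv m) IH poch_tailS.
by rewrite mulrAC geomK ?mul1r.
Qed.

Definition sqexp (j m : nat) : R := q ^+ (m ^ 2 + j * m).

Lemma sqexp0 j : sqexp j 0 = 1.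
Proof. by rewrite /sqexp muln0 expr0. Qed.

Lemma sqexpS j m : sqexp j m.+1 = sqexp j m * (q ^+ m) ^+ 2 * q * q ^+ j.
Proof. by rewrite /sqexp -exprM -!exprD -exprSr -exprD; congr (q ^+ _); lia. Qed.

Lemma sqexpD j d m : sqexp (j + d) m = sqexp j m * (q ^+ m) ^+ d.
Proof. by rewrite /sqexp -exprM -!exprD; congr (q ^+ _); lia. Qed.

Lemma sqexp_large j m : (M <= j)%N || (M <= m)%N -> (0 < m)%N -> sqexp j m = 0.
Proof. by move=> big m0; rewrite /sqexp expq_ge //; nia. Qed.

Lemma sqexp_sum_ge (j : nat) (f : nat -> R) : (M <= j)%N ->
  \sum_(m < M) sqexp j m * f m = f 0%N.
Proof.
move=> leMj; rewrite -(prednK trunc_gt0) big_ord_recl sqexp0 mul1r.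
by rewrite big1 ?addr0 // => i _; rewrite sqexp_large ?leMj ?mul0r.
Qed.

(** Durfee's identity: the sum over m of q^(m^2 + a m) / ((q;q)_m (q;q)_(m+a))
    is 1 / (q;q)_oo, multiplied here by (q;q)_oo.  Writing D(a) for the left-hand
    side, D(a) - D(a+1) = q^(a+1) (D(a+2) - D(a+1)), so that D is constant,
    equal to its value 1 for large a. *)
Lemma durfee a : \sum_(m < M) sqexp a m * (poch_inv m * poch_tail (m + a)) = 1.
Proof.
pose D a := \sum_(m < M) sqexp a m * (poch_inv m * poch_tail (m + a)).
change (D a = 1); elim/downward_ind: a => [a leMa|a IH].
  rewrite /D (sqexp_sum_ge (fun m => poch_inv m * poch_tail (m + a)) leMa).
  by rewrite poch_tail_ge // /poch_inv big_ord0 mulr1.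
suff: D a - D a.+1 = q ^+ a.+1 * (D a.+2 - D a.+1).
  by rewrite (IH a.+2) ?(IH a.+1) // subrr mulr0 => /subr0_eq.
(* The factor of the difference of terms m is
   1 - q^(m+a+1) - q^m; its part 1 - q^m cancels a factor of 1 / (q;q)_m, which
   allows to shift m. *)
pose f m := sqexp a m * (1 - q ^+ m) * poch_inv m * poch_tail (m + a.+1).
have -> : D a - D a.+1 = \sum_(m < M) f m
    - \sum_(m < M) q ^+ a.+1 * (sqexp a.+1 m * poch_inv m * poch_tail (m + a.+1)).
  rewrite -!sumrB; apply: eq_bigr => m _.
  rewrite /f -addn1 sqexpD addnA addn1 (poch_tailS (m + a)) addn1 -addnS exprD exprS.
  by ring.
rewrite sum_shift ?/f; last 2 first.
- by rewrite expr0 subrr mulr0 !mul0r.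
- by rewrite sqexp_large ?leqnn ?orbT ?trunc_gt0 ?mul0r.
rewrite -!sumrB mulr_sumr; apply: eq_bigr => m _.
rewrite sqexpS -(addn2 a) -(addn1 a) !sqexpD -(poch_invS m).
by rewrite !addn1 addn2 addSnnS (exprS q a); ring.
Qed.

(** (q^(3n);q^3)_oo *)
Definition cube_tail (n : nat) : R := \prod_(n <= i < M) (1 - q ^+ (3 * i)).

Lemma cube_tailS n : cube_tail n = (1 - q ^+ (3 * n)) * cube_tail n.+1.
Proof.
rewrite /cube_tail; have [ltnM|leMn] := ltnP n M; first by rewrite big_ltn.
by rewrite !big_geq ?expq_ge ?subr0 ?mulr1 ?(leqW leMn) //; lia.
Qed.

Lemma cube_tail_ge n : (M <= 3 * n)%N -> cube_tail n = 1.
Proof.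
move=> leMn; rewrite /cube_tail big_nat_cond big1 // => i.
by rewrite andbT => /andP[leni _]; rewrite expq_ge ?subr0 //; lia.
Qed.

Definition trinomials (m : nat) : R :=
  \prod_(i < m) (1 + q ^+ i.+1 + (q ^+ i.+1) ^+ 2).

Lemma trinomials_poch m : trinomials m * cube_tail m.+1 = poch_inv m * cube_tail 1.
Proof.
elim: m => [|m IH]; first by rewrite /trinomials /poch_inv !big_ord0.
rewrite /trinomials big_ord_recr /= -/(trinomials m).
rewrite /poch_inv big_ord_recr /= -/(poch_inv m) [in RHS]mulrAC -IH.
rewrite (cube_tailS m.+1) mulnC exprM.
have -> : 1 - (q ^+ m.+1) ^+ 3
  = (1 - q ^+ m.+1) * (1 + q ^+ m.+1 + (q ^+ m.+1) ^+ 2) by ring.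
by rewrite -[LHS]mulr1 -[X in _ * X = _](geomK (ltn0Sn m)); ring.
Qed.

(** (q^3;q^3)_m / (q;q)_m^2 *)
Definition quot_coef (m : nat) : R := trinomials m * poch_inv m.

Lemma quot_coefS m : quot_coef m.+1 * (1 - q ^+ m.+1) =
  quot_coef m * (1 + q ^+ m.+1 + (q ^+ m.+1) ^+ 2).
Proof.
rewrite /quot_coef {1}/trinomials big_ord_recr /= -/(trinomials m) -(poch_invS m).
by ring.
Qed.

Definition closed_form (j : nat) : R :=
  \sum_(m < M) sqexp j m * (quot_coef m * cube_tail ((j + 2) %/ 3 + 1 + m)).

Lemma closed_form_ge j : (M <= j)%N -> closed_form j = 1.
Proof.
move=> leMj; rewrite /closed_form.
rewrite (sqexp_sum_ge
  (fun m => quot_coef m * cube_tail ((j + 2) %/ 3 + 1 + m)) leMj).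
rewrite cube_tail_ge /quot_coef; last by lia.
by rewrite /trinomials /poch_inv !big_ord0 !mulr1.
Qed.

(** After multiplication by (q;q)_oo, which is invertible, both sides are equal
    to (q^3;q^3)_oo: the left one by Durfee's identity. *)
Lemma closed_form0 : closed_form 0 = trinomials M.
Proof.
rewrite /closed_form -[LHS]mul1r -[RHS]mul1r.
have <- : poch_inv M * poch_tail 0 = 1 by rewrite poch_inv_tail poch_tail_ge.
rewrite -!mulrA; congr (_ * _); rewrite mulr_sumr.
transitivity (cube_tail 1); last first.
  rewrite -[LHS]mul1r -[X in X * _](poch_tail_ge (leqnn M)) -poch_inv_tail.
  by rewrite mulrAC -trinomials_poch cube_tail_ge ?mulr1 1?mulrC //; lia.
rewrite -[RHS]mulr1 -(durfee 0) mulr_sumr; apply: eq_bigr => m _.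
rewrite addn0 -(poch_inv_tail m) /quot_coef add1n.
have := trinomials_poch m; set x := _ * cube_tail _ => e.
transitivity (sqexp 0 m * poch_inv m * poch_tail 0 * x); first by rewrite /x; ring.
by rewrite e; ring.
Qed.

(** The recurrence of z(j), the generating function of what may follow a part of
    degree j - 1. *)
Definition recurrence_at (u : nat -> R) (j : nat) : Prop :=
  u j = u j.+1 + q ^+ j.+1 * u j.+2 + q ^+ j.+2 * u j.+3
    + (if (j %% 3 == 0)%N then 0 else q ^+ j.+3 * u j.+4)
    + (if (j %% 3 == 1)%N then q ^+ (j + j + 6) * u j.+4.+1 else 0).

Lemma mod3_cases (P : nat -> Prop) :
  (forall t, P (3 * t)%N) -> (forall t, P (3 * t + 1)%N) ->
  (forall t, P (3 * t + 2)%N) -> forall j, P j.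
Proof.
move=> P0 P1 P2 j; rewrite (divn_eq j 3) mulnC.
have: (j %% 3 < 3)%N by rewrite ltn_mod.
by case: (j %% 3)%N => [|[|[|]]] // _; rewrite ?addn0.
Qed.

Lemma recurrence_unique (u w : nat -> R) :
  (forall j, (M <= j)%N -> u j = 1) -> (forall j, (M <= j)%N -> w j = 1) ->
  (forall j, recurrence_at u j) -> (forall j, recurrence_at w j) ->
  forall j, u j = w j.
Proof.
move=> ularge wlarge urec wrec j.
elim/downward_ind: j => [j leMj|j IH]; first by rewrite ularge ?wlarge.
by rewrite (urec j) (wrec j) !IH //; lia.
Qed.

(** The difference of two consecutive closed forms produces the factor 1 - q^m,
    which [quot_coefS] turns into the shift of m that the recurrence performs. *)
Lemma shifted_sum (j c : nat) :
  \sum_(m < M) sqexp j m * (1 - q ^+ m) * (quot_coef m * cube_tail (c + m))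
  = \sum_(m < M) q ^+ j.+1 * (sqexp j.+2 m
      * (1 + q ^+ m.+1 + (q ^+ m.+1) ^+ 2) * (quot_coef m * cube_tail (c.+1 + m))).
Proof.
rewrite (@sum_shift
  (fun m => sqexp j m * (1 - q ^+ m) * (quot_coef m * cube_tail (c + m)))).
- apply: eq_bigr => m _; rewrite addnS sqexpS -(addn2 j) sqexpD -addSn (exprS q j).
  transitivity (sqexp j m * (q ^+ m) ^+ 2 * q * q ^+ j * cube_tail (c.+1 + m)
    * (quot_coef m.+1 * (1 - q ^+ m.+1))); first by ring.
  by rewrite quot_coefS; ring.
- by rewrite expr0 subrr mulr0 !mul0r.
- by rewrite sqexp_large ?leqnn ?orbT ?trunc_gt0 ?mul0r.
Qed.

(** Here the product in [closed_form] starts at the same factor for j and j + 1,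
    and at the next factor for j + 2, j + 3 and j + 4. *)
Lemma closed_form_mod2 t : recurrence_at closed_form (3 * t + 2).
Proof.
rewrite /recurrence_at (_ : (3 * t + 2) %% 3 = 2)%N /= ?addr0; last by lia.
set j := (3 * t + 2)%N.
suff E : closed_form j - closed_form j.+1 = q ^+ j.+1 * closed_form j.+2
    + q ^+ j.+2 * closed_form j.+3 + q ^+ j.+3 * closed_form j.+4.
  by rewrite -[LHS](subrK (closed_form j.+1)) E; ring.
rewrite /closed_form.
have -> : ((j + 2) %/ 3 + 1 = t.+2)%N by lia.
have -> : ((j.+1 + 2) %/ 3 + 1 = t.+2)%N by lia.
have -> : ((j.+2 + 2) %/ 3 + 1 = t.+3)%N by lia.
have -> : ((j.+3 + 2) %/ 3 + 1 = t.+3)%N by lia.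
have -> : ((j.+4 + 2) %/ 3 + 1 = t.+3)%N by lia.
transitivity (\sum_(m < M) sqexp j m * (1 - q ^+ m)
    * (quot_coef m * cube_tail (t.+2 + m))).
  by rewrite -sumrB; apply: eq_bigr => m _; rewrite -(addn1 j) sqexpD; ring.
rewrite shifted_sum !mulr_sumr -!big_split /=; apply: eq_bigr => m _.
clearbody j; rewrite -(addn4 j) -(addn3 j) -(addn2 j) !sqexpD.
by rewrite ?exprD ?(exprS q m) ?(exprS q j); ring.
Qed.

(** The product for j + 2 has one factor more than those for j + 3, j + 4 and
    j + 5; the last term of the recurrence compensates for this factor. *)
Lemma closed_form_mod1 t : recurrence_at closed_form (3 * t + 1).
Proof.
rewrite /recurrence_at (_ : (3 * t + 1) %% 3 = 1)%N /=; last by lia.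
set j := (3 * t + 1)%N.
suff E : closed_form j - closed_form j.+1 = q ^+ j.+1 * closed_form j.+2
    + q ^+ j.+2 * closed_form j.+3 + q ^+ j.+3 * closed_form j.+4
    + q ^+ (j + j + 6) * closed_form j.+4.+1.
  by rewrite -[LHS](subrK (closed_form j.+1)) E; ring.
rewrite /closed_form.
have -> : ((j + 2) %/ 3 + 1 = t.+2)%N by lia.
have -> : ((j.+1 + 2) %/ 3 + 1 = t.+2)%N by lia.
have -> : ((j.+2 + 2) %/ 3 + 1 = t.+2)%N by lia.
have -> : ((j.+3 + 2) %/ 3 + 1 = t.+3)%N by lia.
have -> : ((j.+4 + 2) %/ 3 + 1 = t.+3)%N by lia.
have -> : ((j.+4.+1 + 2) %/ 3 + 1 = t.+3)%N by lia.
transitivity (\sum_(m < M) sqexp j m * (1 - q ^+ m)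
    * (quot_coef m * cube_tail (t.+2 + m))).
  by rewrite -sumrB; apply: eq_bigr => m _; rewrite -(addn1 j) sqexpD; ring.
rewrite shifted_sum !mulr_sumr -!big_split /=; apply: eq_bigr => m _.
rewrite (cube_tailS (t.+2 + m)).
have -> : (3 * (t.+2 + m) = j + m * 3 + 5)%N by lia.
have -> : (j.+4.+1 = j + 5)%N by lia.
clearbody j.
rewrite -(addn4 j) -(addn3 j) -(addn2 j) !sqexpD -addSn.
by rewrite !exprD exprM ?(exprS q m) ?(exprS q j); ring.
Qed.

(** The product for j has one factor 1 - q^(j+3+3m) more than that for j + 1.
    With x = q^m and y = q^(j+3+3m), the difference of the terms m has the factor
    1 - y - x = (1 - x) (1 - y) - x y.  In the shifted sum of the first part, the
    summand q^(2m+2), which gives the term q^(j+3) z(j+4) for the other residues,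
    is cancelled by the second part. *)
Lemma closed_form_mod0 t : recurrence_at closed_form (3 * t).
Proof.
rewrite /recurrence_at (_ : (3 * t) %% 3 = 0)%N /= ?addr0; last by lia.
set j := (3 * t)%N.
suff E : closed_form j - closed_form j.+1 =
    q ^+ j.+1 * closed_form j.+2 + q ^+ j.+2 * closed_form j.+3.
  by rewrite -[LHS](subrK (closed_form j.+1)) E; ring.
rewrite /closed_form.
have -> : ((j + 2) %/ 3 + 1 = t.+1)%N by lia.
have -> : ((j.+1 + 2) %/ 3 + 1 = t.+2)%N by lia.
have -> : ((j.+2 + 2) %/ 3 + 1 = t.+2)%N by lia.
have -> : ((j.+3 + 2) %/ 3 + 1 = t.+2)%N by lia.
transitivity (\sum_(m < M) sqexp j m * (1 - q ^+ m)
      * (quot_coef m * cube_tail (t.+1 + m))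
    - \sum_(m < M) q ^+ (j + 3) * (q ^+ m) ^+ 4 * sqexp j m
      * (quot_coef m * cube_tail (t.+2 + m))).
  rewrite -!sumrB; apply: eq_bigr => m _.
  rewrite (cube_tailS (t.+1 + m)) -(addn1 j) sqexpD.
  have -> : (3 * (t.+1 + m) = j + 3 + m * 3)%N by lia.
  by rewrite (exprD q (j + 3)) exprM; ring.
rewrite shifted_sum !mulr_sumr -sumrB -big_split /=; apply: eq_bigr => m _.
clearbody j; rewrite -(addn3 j) -(addn2 j) !sqexpD.
by rewrite ?exprD ?(exprS q m) ?(exprS q j); ring.
Qed.

Lemma closed_form_rec j : recurrence_at closed_form j.
Proof.
by elim/mod3_cases: j;
  [exact: closed_form_mod0 | exact: closed_form_mod1 | exact: closed_form_mod2].
Qed.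

End TruncatedSeries.

(** * Words accepted by an automaton *)

Section Words.

Variables (A : eqType) (S : Type) (alph : seq A) (mul : A -> nat).
Variables (ok : nat -> S -> A -> bool) (push : S -> A -> S).

(** [ok r s x] allows the letter x in degree r when the state is s; a letter x
    stands for [mul x] parts. *)
Fixpoint accepted (r : nat) (s : S) (w : seq A) : bool :=
  if w is x :: w' then ok r s x && accepted r.+1 (push s x) w' else true.

Fixpoint word_weight (r : nat) (w : seq A) : nat :=
  if w is x :: w' then r * mul x + word_weight r.+1 w' else 0.

Fixpoint words (l r : nat) (s : S) : seq (seq A) :=
  if l is l'.+1 then
    flatten [seq [seq x :: w | w <- words l' r.+1 (push s x)]
            | x <- alph & ok r s x]
  else [:: [::]].

Lemma mem_words l r s w : (w \in words l r s)
  = [&& size w == l, all (mem alph) w & accepted r s w].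
Proof.
elim: l r s w => [|l IH] r s [|x w] //=.
  by apply/flatten_mapP => -[y _ /mapP[]].
apply/flatten_mapP/idP => [[y]|].
  rewrite mem_filter => /andP[okx xA] /mapP[v]; rewrite IH => /and3P[sv av acv].
  by case=> -> ->; rewrite eqSS sv xA av okx acv.
rewrite eqSS => /and3P[sw /andP[xA aw] /andP[okx acw]].
exists x; first by rewrite mem_filter okx.
by apply: map_f; rewrite IH sw aw acw.
Qed.

Lemma uniq_words l r s : uniq alph -> uniq (words l r s).
Proof.
move=> uA; elim: l r s => [|l IH] r s //=.
apply: (@allpairs_uniq_dep _ _ _ (fun x w => x :: w)).
- exact: filter_uniq.
- by move=> x _; apply: IH.
- by move=> [x v] [y w] _ _ /= [-> ->].
Qed.

Section Series.
Local Open Scope ring_scope.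
Variables (R : comNzRingType) (q : R).

Definition series (l r : nat) (s : S) : R :=
  \sum_(w <- words l r s) q ^+ word_weight r w.

Lemma series0 r s : series 0 r s = 1.
Proof. by rewrite /series big_seq1 expr0. Qed.

Lemma seriesS l r s : series l.+1 r s =
  \sum_(x <- alph | ok r s x) q ^+ (r * mul x) * series l r.+1 (push s x).
Proof.
rewrite /series /= big_flatten big_map big_filter; apply: eq_bigr => x _.
by rewrite big_map mulr_sumr; apply: eq_bigr => w _; rewrite /= exprD.
Qed.
End Series.

End Words.

(** * The automaton of the coloured partitions *)

Section Transfer.

(** In the next four definitions, rho is the degree modulo 3 of the part that is
    added, of colour c. *)
Definition colour_ok (rho : nat) (c : color) : bool :=
  match rho, c with 0, DoublyUnderlined => false | _, _ => true end.

Definition gap2_ok (rho : nat) (b c : color) : bool :=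
  match rho, b, c with
  | 0, Plain, Underlined | 0, Underlined, Plain | 0, DoublyUnderlined, Plain
  | 1, Plain, Plain | 1, Underlined, Underlined
  | 1, DoublyUnderlined, DoublyUnderlined
  | 2, Plain, Underlined | 2, Plain, DoublyUnderlined
  | 2, Underlined, Plain => true
  | _, _, _ => false
  end.

Definition gap3_ok (rho : nat) (b c : color) : bool :=
  match rho, b, c with
  | 0, _, _ => true
  | _, Plain, Plain | _, Underlined, Underlined
  | _, DoublyUnderlined, DoublyUnderlined => false
  | _, _, _ => true
  end.

(** Of the first two colours, a is found four degrees and b two degrees before
    the new part.  The match starts with b, so that it reduces when b is absent. *)
Definition triple_ok (rho : nat) (a b : option color) (c : color) : bool :=
  match b, rho, a, c with
  | Some Plain, 2, Some Underlined, DoublyUnderlined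
  | Some Plain, 2, Some DoublyUnderlined, Underlined => false
  | _, _, _, _ => true
  end.

(** [backi] is the letter i degrees before the current one. *)
Record window := Window
  { back4 : option color; back3 : option color;
    back2 : option color; back1 : option color }.

Definition letter_ok (r : nat) (s : window) (x : option color) : bool :=
  if x is Some c then
    [&& colour_ok (r %% 3) c, back1 s == None,
        (if back2 s is Some b then gap2_ok (r %% 3) b c else true),
        (if back3 s is Some b then gap3_ok (r %% 3) b c else true)
      & triple_ok (r %% 3) (back4 s) (back2 s) c]
  else true.

Definition slide (s : window) (x : option color) : window :=
  Window (back3 s) (back2 s) (back1 s) x.

Definition letters : seq (option color) :=
  [:: None; Some Plain; Some Underlined; Some DoublyUnderlined].

Definition present (x : option color) : nat := if x is Some _ then 1 else 0.

Local Open Scope ring_scope.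

Variables (R : comNzRingType) (q : R) (M : nat).
Hypothesis qM0 : q ^+ M = 0.

(** The generating function of the words that fill the degrees from r on, after
    the window s.  Words may stop before degree M, since q^M = 0; letting their
    length depend on r makes [completions_step] valid for all r. *)
Definition completions (r : nat) (s : window) : R :=
  series letters present letter_ok slide q (M - r) r s.

Lemma completions_ge r s : (M <= r)%N -> completions r s = 1.
Proof. by rewrite /completions -subn_eq0 => /eqP ->; exact: series0. Qed.

Definition guard (b : bool) (x : R) : R := if b then x else 0.

Definition push_part r s c : R :=
  guard (letter_ok r s (Some c)) (q ^+ r * completions r.+1 (slide s (Some c))).

Lemma completions_step r s : completions r s = completions r.+1 (slide s None)
  + push_part r s Plain + push_part r s Underlined + push_part r s DoublyUnderlined.
Proof.
have [leMr|ltrM] := leqP M r.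
  have qr0 c : push_part r s c = 0.
    by rewrite /push_part (expq_ge qM0 leMr) mul0r /guard; case: ifP.
  by rewrite !qr0 !addr0 !completions_ge // ltnW.
rewrite {1}/completions -(subnSK ltrM) seriesS big_mkcond /letters !big_cons big_nil.
by rewrite muln0 expr0 mul1r !muln1 -!addrA -[push_part _ _ DoublyUnderlined]addr0.
Qed.

Definition unrestricted (j : nat) : R := completions j (Window None None None None).

Lemma completions_unrestricted a j : completions j (Window a None None None) = unrestricted j.
Proof. by rewrite /unrestricted [LHS]completions_step [RHS]completions_step. Qed.

(** The part of colour c has degree j - 1, and a and b are the letters of degrees
    j - 4 and j - 3. *)
Definition after (j : nat) (a b : option color) (c : color) : R :=
  completions j (Window a b None (Some c)).

Definition sum3 (F : color -> R) : R := F Plain + F Underlined + F DoublyUnderlined.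

Lemma unrestricted_step j : unrestricted j =
  unrestricted j.+1 + sum3 (fun c => guard (colour_ok (j %% 3) c) (q ^+ j * after j.+1 None None c)).
Proof.
rewrite {1}/unrestricted completions_step completions_unrestricted /sum3 -!addrA; congr (_ + (_ + (_ + _)));
  by rewrite /push_part /letter_ok /= ?andbT.
Qed.

(** Nothing follows a part in the next degree; it restricts the parts that come two
    or three degrees later, and no others. *)
Lemma after_step j a b c : after j a b c = unrestricted j.+3
  + sum3 (fun c2 => guard [&& colour_ok (j.+1 %% 3) c2, gap2_ok (j.+1 %% 3) c c2
                          & triple_ok (j.+1 %% 3) b (Some c) c2]
                      (q ^+ j.+1 * after j.+2 None (Some c) c2))
  + sum3 (fun c3 => guard (colour_ok (j.+2 %% 3) c3 && gap3_ok (j.+2 %% 3) c c3)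
                      (q ^+ j.+2 * after j.+3 (Some c) None c3)).
Proof.
have forced i s : back1 s != None -> completions i s = completions i.+1 (slide s None).
  move=> /negbTE s1; rewrite completions_step /push_part /letter_ok s1 !andbF.
  by rewrite /guard !addr0.
rewrite /after forced // /slide /= completions_step.
rewrite /push_part /letter_ok /slide [X in X + _ + _ + _]completions_step completions_unrestricted.
rewrite /push_part /letter_ok /slide /= /sum3 /after.
rewrite !andbT.
by rewrite -!addrA; congr (_ + _); rewrite !addrA; ring.
Qed.

(** The underlined part represents all colours when j - 1 is not divisible by 3;
    otherwise it is the one with fewer successors. *)
Definition z_series (j : nat) : R := after j None None Underlined.

(** The colour of a part of degree j - 1 is irrelevant, unless j - 1 is divisible
    by 3.  A plain part then admits one more colour than an underlined part at
    distance two; the three-term condition takes this colour away again if b, the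
    letter two degrees before the part, is underlined or doubly underlined. *)
Definition colour_rule (j : nat) : Prop :=
  forall a b c,
  match (j %% 3)%N, c with
  | 1%N, DoublyUnderlined => True
  | 1%N, Plain => after j a b c = z_series j +
      (if b is (Some Underlined | Some DoublyUnderlined) then 0
       else q ^+ j.+1 * z_series j.+2)
  | _, _ => after j a b c = z_series j
  end.

Lemma after_ge j a b c : (M <= j)%N -> after j a b c = 1.
Proof. exact: completions_ge. Qed.

Definition z_series_step j := after_step j None None Underlined : z_series j = _.

Lemma colour_ruleP j : colour_rule j.
Proof.
elim/(downward_ind (M := M)): j => [j leMj|j IH] a b c.
  have qj0 : q ^+ j.+1 = 0 by apply: (expq_ge qM0); apply: leqW.
  have E b' : 1 = 1 + (if b' is (Some Underlined | Some DoublyUnderlined) then 0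
      else q ^+ j.+1 * z_series j.+2).
    by rewrite qj0 mul0r; case: b' => [[]|]; rewrite addr0.
  rewrite after_ge // /(z_series j) after_ge //.
  by case: (j %% 3)%N => [|[|i]] //; case: c.
have IH2 := IH j.+2 _; have IH3 := IH j.+3 _.
rewrite (z_series_step j) [after j a b c]after_step /sum3.
have [E|E|E] : [\/ j %% 3 = 0, j %% 3 = 1 | j %% 3 = 2]%N.
- have: (j %% 3 < 3)%N by rewrite ltn_mod.
  by case: (j %% 3)%N => [|[|[|]]] //; [constructor 1|constructor 2|constructor 3].
- have E1 : (j.+1 %% 3 = 1)%N by lia.
  have E2 : (j.+2 %% 3 = 2)%N by lia.
  have E3 : (j.+3 %% 3 = 0)%N by lia.
  move: (IH2 (ltnW (ltnSn _))) (IH3 (ltnW (ltnW (ltnSn _)))).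
  rewrite /colour_rule E E1 E2 E3 => I2 I3.
  by case: c => /=; rewrite !I2 !I3; ring.
- have E1 : (j.+1 %% 3 = 2)%N by lia.
  have E2 : (j.+2 %% 3 = 0)%N by lia.
  have E3 : (j.+3 %% 3 = 1)%N by lia.
  move: (IH2 (ltnW (ltnSn _))) (IH3 (ltnW (ltnW (ltnSn _)))).
  rewrite /colour_rule E E1 E2 E3 => I2 I3.
  have I3u a' b' := I3 a' b' Underlined; have I3p a' b' := I3 a' b' Plain.
  by case: c => //=; last rewrite !I2 !I3u !I3p; first case: b => [[]|] /=;
    rewrite ?I2 ?I3u ?I3p; ring.
- have E1 : (j.+1 %% 3 = 0)%N by lia.
  have E2 : (j.+2 %% 3 = 1)%N by lia.
  have E3 : (j.+3 %% 3 = 2)%N by lia.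
  move: (IH2 (ltnW (ltnSn _))) (IH3 (ltnW (ltnW (ltnSn _)))).
  rewrite /colour_rule E E1 E2 E3 => I2 I3.
  have Iu a' b' := I2 a' b' Underlined; have Ip a' b' := I2 a' b' Plain.
  by case: c => /=; rewrite ?Iu ?Ip !I3; ring.
Qed.

(** The series of the parts in degree j + 3 or later that follow without any
    restriction is eliminated between z(j) and z(j+1), by [unrestricted_step]. *)
Lemma z_series_rec j : recurrence_at q z_series j.
Proof.
elim/mod3_cases: j => t; set j := (X in recurrence_at _ _ X); rewrite /recurrence_at.
- have E0 : (j %% 3 = 0)%N by lia.
  have E1 : (j.+1 %% 3 = 1)%N by lia.
  have E2 : (j.+2 %% 3 = 2)%N by lia.
  have E3 : (j.+3 %% 3 = 0)%N by lia.
  have E4 : (j.+4 %% 3 = 1)%N by lia.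
  have := colour_ruleP j.+2; have := colour_ruleP j.+3; have := colour_ruleP j.+4.
  rewrite /colour_rule E0 E2 E3 E4 => I4 I3 I2.
  have I4u a b := I4 a b Underlined; have I4p a b := I4 a b Plain.
  rewrite (z_series_step j) (z_series_step j.+1) (unrestricted_step j.+3).
  by rewrite /sum3 E1 E2 E3 /= !I2 !I3 !I4u !I4p; ring.
- have E0 : (j %% 3 = 1)%N by lia.
  have E1 : (j.+1 %% 3 = 2)%N by lia.
  have E2 : (j.+2 %% 3 = 0)%N by lia.
  have E3 : (j.+3 %% 3 = 1)%N by lia.
  have E4 : (j.+4 %% 3 = 2)%N by lia.
  have := colour_ruleP j.+2; have := colour_ruleP j.+3; have := colour_ruleP j.+4.
  rewrite /colour_rule E0 E2 E3 E4 => I4 I3 I2.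
  have I3u a b := I3 a b Underlined; have I3p a b := I3 a b Plain.
  have -> : q ^+ (j + j + 6) = q ^+ j.+2 * q ^+ j.+4.
    by rewrite -exprD; congr (q ^+ _); lia.
  rewrite (z_series_step j) (z_series_step j.+1) (unrestricted_step j.+3).
  by rewrite /sum3 E1 E2 E3 /= !I2 !I3u !I3p !I4; ring.
- have E0 : (j %% 3 = 2)%N by lia.
  have E1 : (j.+1 %% 3 = 0)%N by lia.
  have E2 : (j.+2 %% 3 = 1)%N by lia.
  have E3 : (j.+3 %% 3 = 2)%N by lia.
  have E4 : (j.+4 %% 3 = 0)%N by lia.
  have := colour_ruleP j.+2; have := colour_ruleP j.+3; have := colour_ruleP j.+4.
  rewrite /colour_rule E0 E2 E3 E4 => I4 I3 I2.
  have I2p a b := I2 a b Plain.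
  rewrite (z_series_step j) (z_series_step j.+1) (unrestricted_step j.+3).
  by rewrite /sum3 E1 E2 E3 /= !I2p !I3 !I4; ring.
Qed.

Lemma z_seriesE j : z_series j = closed_form q M j.
Proof.
apply: (@recurrence_unique R q M); first exact: (fun i => @after_ge i _ _ _).
- exact: (closed_form_ge qM0).
- exact: z_series_rec.
- exact: (closed_form_rec qM0).
Qed.

End Transfer.

(** * Counting by words *)

Lemma card_fset_set_code (T B : choiceType) (X : set T) (W : seq B) (code : T -> B) :
  finite_set X -> uniq W ->
  (forall f, X f -> code f \in W) ->
  (forall f g, X f -> X g -> code f = code g -> f = g) ->
  (forall w, w \in W -> exists2 f, X f & code f = w) ->
  #|` fset_set X| = size W.
Proof.
move=> finX uW codeW inj surj.
have memX f : (f \in fset_set X) = (f \in X) by rewrite in_fset_set.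
have <- : #|` [fset code f | f in fset_set X]%fset| = #|` fset_set X|.
  rewrite card_in_imfset // => f g /=.
  by rewrite !memX => /set_mem Xf /set_mem Xg; apply: inj.
rewrite -(undup_id uW) -card_fseq; congr #|` _|; apply/fsetP => w.
rewrite in_fset /=; apply/imfsetP/idP => [[f /=]|/surj[f Xf <-]].
  by rewrite memX => /set_mem/codeW Wf ->.
by exists f; rewrite //= memX; apply/mem_set.
Qed.

Section Weight.
Variables (T : choiceType) (deg : T -> nat).

Lemma weight_ge (f : {fsfun T -> nat with 0}) a : deg a * f a <= weight deg f.
Proof.
have [aS|aS] := boolP (a \in finsupp f); last by rewrite fsfun_dflt // muln0.
by rewrite /weight (big_fsetD1 a) //= leq_addr.
Qed.

Lemma weight_seq (f : {fsfun T -> nat with 0}) (s : seq T) : uniq s ->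
  (forall a, f a != 0 -> a \in s) -> weight deg f = \sum_(a <- s) deg a * f a.
Proof.
move=> us supp; rewrite [RHS](bigID (fun a => a \in finsupp f)) /=.
rewrite [X in _ + X]big1 ?addn0; last first.
  by move=> a aS; rewrite fsfun_dflt // muln0.
rewrite -big_filter; apply: perm_big; apply: uniq_perm.
- exact: fset_uniq.
- exact: filter_uniq.
move=> a; rewrite mem_filter; case: (boolP (a \in finsupp f)) => //= aS.
by rewrite supp // -mem_finsupp.
Qed.
End Weight.

Definition zpos_upto (n : nat) : seq zpos := pmap insub (iota 1 n).

Lemma val_zpos_upto n : map val (zpos_upto n) = iota 1 n.
Proof.
rewrite /zpos_upto (pmap_filter (insubK _)); apply/all_filterP/allP => r.
by rewrite mem_iota isSome_insub => /andP[].
Qed.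

Lemma mem_zpos_upto n (p : zpos) : (p \in zpos_upto n) = (val p <= n).
Proof. by rewrite -(mem_map val_inj) val_zpos_upto mem_iota (valP p) add1n. Qed.

Lemma uniq_zpos_upto n : uniq (zpos_upto n).
Proof. by rewrite -(map_inj_uniq val_inj) val_zpos_upto iota_uniq. Qed.

Lemma sum_zpos_upto n (F : nat -> nat) :
  \sum_(p <- zpos_upto n) F (val p) = \sum_(r <- iota 1 n) F r.
Proof. by rewrite -val_zpos_upto big_map. Qed.

Lemma word_weight_map (A : eqType) (mul : A -> nat) (g : nat -> A) r l :
  word_weight mul r [seq g i | i <- iota r l] = \sum_(i <- iota r l) i * mul (g i).
Proof.
elim: l r => [|l IH] r /=; first by rewrite big_nil.
by rewrite big_cons IH.
Qed.

Section Coefficient.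
Local Open Scope ring_scope.
Variable n : nat.
Notation Rn := {poly %/ ('X^(n.+1) : {poly int})}.
Notation qn := ('qX : Rn).

Let size_modulus : size (mk_monic ('X^(n.+1) : {poly int})) = n.+2.
Proof. by rewrite mk_monic_Xn size_polyXn. Qed.

Let qnE k : qn ^+ k = in_qpoly _ 'X^k.
Proof. by rewrite /qpolyX -rmorphXn. Qed.

Lemma qX_nilpotent : qn ^+ n.+1 = 0.
Proof.
rewrite qnE; apply/val_inj => /=; rewrite mk_monic_Xn.
by rewrite Pdiv.RingMonic.rmodpp ?monicXn.
Qed.

Lemma coef_qX k : ((qn ^+ k : Rn) : {poly int})`_n = (k == n)%:R.
Proof.
have [ltnk|lekn] := ltnP n k.
  by rewrite -(subnKC ltnk) exprD qX_nilpotent mul0r coef0 gtn_eqF ?addSn ?ltnS ?leq_addr.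
by rewrite qnE in_qpoly_small ?size_modulus ?size_polyXn ?ltnS // coefXn eq_sym.
Qed.

Lemma coef_series (A : eqType) (S : Type) (alph : seq A) (mul : A -> nat) ok push l r s :
  ((@series A S alph mul ok push Rn qn l r s : Rn) : {poly int})`_n =
  (size [seq w <- words alph ok push l r s | word_weight mul r w == n])%:R.
Proof.
rewrite /series poly_of_qpoly_sum coef_sum size_filter -sum1_count natr_sum [RHS]big_mkcond /=.
by apply: eq_bigr => w _; rewrite coef_qX; case: eqP.
Qed.
End Coefficient.

(** * One-colour partitions *)

Section OneColour.

Definition multiplicities : seq nat := [:: 0; 1; 2].

(** The letter in degree r is the multiplicity of r; a single state suffices. *)
Definition frequency_words (n : nat) : seq (seq nat) :=
  words multiplicities (fun _ _ _ => true) (fun (_ : unit) _ => tt) n 1 tt.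

Lemma mem_frequency_words n w :
  (w \in frequency_words n) = (size w == n) && all (fun m => m <= 2) w.
Proof.
rewrite /frequency_words mem_words; congr (_ && _).
have -> r : accepted (fun _ _ _ => true) (fun (_ : unit) _ => tt) r tt w = true.
  by elim: w r => //= x w IH r; rewrite IH.
by rewrite andbT; apply: eq_all => -[|[|[|]]].
Qed.

Lemma series_frequency_words (R : comNzRingType) (q : R) l r :
  series multiplicities id (fun _ _ _ => true) (fun (_ : unit) _ => tt) q l r tt
  = (\prod_(i <- iota r l) (1 + q ^+ i + (q ^+ i) ^+ 2))%R.
Proof.
elim: l r => [|l IH] r; first by rewrite series0 big_nil.
rewrite seriesS [RHS]big_cons -IH !big_cons big_nil /= muln0 muln1 exprM.
by rewrite expr0; ring.
Qed.

Definition multz (f : one_color_partition) (r : nat) : nat :=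
  if insub r is Some p then f p else 0.

Lemma multzE f (p : zpos) : multz f (val p) = f p.
Proof. by rewrite /multz valK. Qed.

Lemma card_one_colour n :
  #|` fset_set [set f : one_color_partition |
        one_color_partitions_of n f /\ (forall a, f a <= 2)]%classic |
  = size [seq w <- frequency_words n | word_weight id 1 w == n].
Proof.
have supp (f : one_color_partition) :
    one_color_partitions_of n f -> forall p, f p != 0 -> p \in zpos_upto n.
  move=> <- p fp; rewrite mem_zpos_upto.
  by apply: leq_trans (weight_ge _ f p); rewrite leq_pmulr ?lt0n.
have wt (f : one_color_partition) : (forall p, f p != 0 -> p \in zpos_upto n) ->
    weight (fun r : zpos => val r) f = word_weight id 1 [seq multz f i | i <- iota 1 n].
  move=> fs; rewrite (weight_seq _ (uniq_zpos_upto n) fs) word_weight_map.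
  by rewrite -sum_zpos_upto; apply: eq_bigr => p _; rewrite multzE.
apply: (@card_fset_set_code _ _ _ _ (fun f => [seq multz f i | i <- iota 1 n])).
- apply: sub_finite_set (finite_one_color_partitions_of n).
  by move=> f [].
- by rewrite filter_uniq ?uniq_words.
- move=> f [fn f2]; rewrite mem_filter -(wt _ (supp _ fn)) fn eqxx /=.
  rewrite mem_frequency_words size_map size_iota eqxx /= all_map.
  by apply/allP => r _ /=; rewrite /multz; case: insub.
- move=> f g [fn _] [gn _] /eq_in_map fg; apply/fsfunP => p.
  have [pn|pn] := boolP (p \in zpos_upto n); last first.
    by rewrite (contraNeq (supp _ fn p) pn) (contraNeq (supp _ gn p) pn).
  rewrite -!multzE; apply: fg; rewrite mem_iota (valP p) add1n ltnS.
  by rewrite -mem_zpos_upto.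
move=> w; rewrite mem_filter mem_frequency_words => /andP[/eqP ww /andP[/eqP sw /allP w2]].
pose f : one_color_partition :=
  [fsfun p in [fset p in zpos_upto n]%fset => nth 0 w (val p).-1 | 0].
have fE p : f p = if p \in zpos_upto n then nth 0 w (val p).-1 else 0.
  by rewrite fsfun_fun in_fset.
have fs p : f p != 0 -> p \in zpos_upto n by rewrite fE; case: ifP.
have fw : [seq multz f i | i <- iota 1 n] = w.
  apply: (@eq_from_nth _ 0); rewrite size_map size_iota // => i ltin.
  rewrite (nth_map 0) ?size_iota // nth_iota // add1n /multz insubT /=.
  by rewrite fE mem_zpos_upto /= ltin.
exists f => //; split; first by rewrite /one_color_partitions_of /= wt // fw.
move=> p; rewrite fE; case: ifP => // pn; apply: w2; apply: mem_nth.
by rewrite sw prednK ?(valP p) // -mem_zpos_upto.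
Qed.

Lemma size_frequency_words n : let Rn := {poly %/ ('X^(n.+1) : {poly int})}%R in
  ((size [seq w <- frequency_words n | word_weight id 1 w == n])%:R : int)%R
  = (((trinomials ('qX : Rn) n.+1 : Rn) : {poly int})`_n)%R.
Proof.
move=> Rn; rewrite -coef_series series_frequency_words; congr (((_ : Rn) : {poly int})`_n)%R.
have qn0 := qX_nilpotent n.
rewrite /trinomials big_ord_recr /= qn0 expr0n !addr0 mulr1.
by rewrite -[iota 1 n]/(iota (1 + 0) n) iotaDl big_map -[n in iota 0 n]subn0
  -/(index_iota 0 n) big_mkord.
Qed.
End OneColour.

(** * The conditions on coloured partitions as acceptance by the automaton *)

Section Acceptance.

Variable g : nat -> option color.
Hypothesis g0 : g 0 = None.

(** The letters from degree -3 on.  The doubly underlined letter in degree -1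
    encodes the initial condition: a part of degree 1 after it must have the same
    colour, and a part of degree 2 a different one. *)
Definition history (k : nat) : option color :=
  if k is k'.+3 then g k' else if k == 2 then Some DoublyUnderlined else None.

Definition window_at (r : nat) : window :=
  Window (history r.-1) (history r) (history r.+1) (history r.+2).

Lemma accepted_map l r : 0 < r ->
  accepted letter_ok slide r (window_at r) [seq g i | i <- iota r l]
  = all (fun i => letter_ok i (window_at i) (g i)) (iota r l).
Proof.
elim: l r => [|l IH] [|r] //= _; congr (_ && _).
by rewrite -(IH r.+2).
Qed.

Definition gap2_free (rho : nat) (x y : option color) : bool :=
  if x is Some b then if y is Some c then gap2_ok rho b c else true else true.

Definition gap3_free (rho : nat) (x y : option color) : bool :=
  if x is Some b then if y is Some c then gap3_ok rho b c else true else true.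

Definition triple_free (x y z : option color) : bool :=
  if z is Some c then triple_ok 2 x y c else true.

(** With x1, ..., x5 in degrees 3i + 1, ..., 3i + 5: the forbidden pairs and triples
    whose last part has degree 3i + 3, 3i + 4 or 3i + 5.  A part of degree 3i + 3
    is compatible with all parts three degrees before it, so that the letter of
    degree 3i does not matter. *)
Definition period_ok (x1 x2 x3 x4 x5 : option color) : bool :=
  [&& gap2_free 0 x1 x3, gap2_free 1 x2 x4, gap2_free 2 x3 x5,
      gap3_free 1 x1 x4, gap3_free 2 x2 x5 & triple_free x1 x3 x5].

Definition admissible : Prop :=
  [/\ forall r, if g r is Some c then colour_ok (r %% 3) c else true,
      forall r, (g r == None) || (g r.+1 == None),
      g 1 = None \/ g 1 = Some DoublyUnderlined, g 2 <> Some DoublyUnderlined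
    & forall i, period_ok (g (3 * i + 1)) (g (3 * i + 2)) (g (3 * i + 3))
        (g (3 * i + 4)) (g (3 * i + 5))].

Lemma admissibleE :
  (forall r, 0 < r -> letter_ok r (window_at r) (g r)) <-> admissible.
Proof.
split=> [ok|[colok adj g1 g2 per]].
  have adj r : (g r == None) || (g r.+1 == None).
    have := ok r.+1 isT; rewrite /letter_ok /=.
    by case: (g r.+1) => [c /and5P[_ -> //]|]; rewrite orbT.
  split=> //.
  - case=> [|r]; first by rewrite g0.
    by have := ok r.+1 isT; rewrite /letter_ok; case: (g r.+1) => [c /and5P[]|].
  - by have := ok 1 isT; rewrite /letter_ok /= g0; case: (g 1) => [[]|] /=; auto.
  - have := ok 2 isT; rewrite /letter_ok /= g0; case: (g 2) => [[]|] //=.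
    by rewrite andbF.
  move=> i; have := ok (3 * i + 3) (ltn_addl _ (isT : 0 < 3)).
  have := ok (3 * i + 4) (ltn_addl _ (isT : 0 < 4)).
  have := ok (3 * i + 5) (ltn_addl _ (isT : 0 < 5)).
  have -> : 3 * i + 5 = (3 * i + 1).+4 by lia.
  have -> : 3 * i + 4 = (3 * i + 1).+3 by lia.
  have -> : 3 * i + 3 = (3 * i + 1).+2 by lia.
  have -> : 3 * i + 2 = (3 * i + 1).+1 by lia.
  rewrite /letter_ok /=.
  have -> : (3 * i + 1).+2 %% 3 = 0 by lia.
  have -> : (3 * i + 1).+3 %% 3 = 1 by lia.
  have -> : (3 * i + 1).+4 %% 3 = 2 by lia.
  move: (g (3 * i + 1)) (g (3 * i + 1).+1) (g (3 * i + 1).+2) (g (3 * i + 1).+3).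
  move: (g (3 * i + 1).+4) => x5 x1 x2 x3 x4.
  rewrite /period_ok /gap2_free /gap3_free /triple_free.
  move=> h5 h4 h3; apply/andP; split; last (apply/and5P; split).
  - by case: x1 x3 h3 {h4 h5} => [b|] // [c|] // /and5P[].
  - by case: x2 x4 h4 {h3 h5} => [b|] // [c|] // /and5P[].
  - by case: x3 x5 h5 {h3 h4} => [b|] // [c|] // /and5P[].
  - by case: x1 x4 h4 {h3 h5} => [b|] // [c|] // /and5P[].
  - by case: x2 x5 h5 {h3 h4} => [b|] // [c|] // /and5P[].
  - by case: x5 h5 {h3 h4} => [c|] // /and5P[].
case=> [//|[_|[_|r _]]].
- by rewrite /letter_ok /= g0; case: g1 => ->.
- have := adj 1; rewrite /letter_ok /= g0; case: (g 2) g2 => [c|] //=.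
  by rewrite orbF => + ->; case: c.
have colok3 := colok r.+3; have adj2 := adj r.+2.
have := per (r %/ 3); move: colok3 adj2; rewrite /letter_ok.
have E : r = 3 * (r %/ 3) + r %% 3 by rewrite mulnC -divn_eq.
have : r %% 3 < 3 by rewrite ltn_mod.
move: (r %/ 3) E => i; case: (r %% 3) => [|[|[|//]]] -> _;
  rewrite ?addn0 ?addn1 ?addn2 ?addn3 ?addn4 (_ : 3 * i + 5 = (3 * i).+4.+1) /=;
  try lia.
- rewrite (_ : (3 * i).+3 %% 3 = 0); last by lia.
  case: (g (3 * i).+3) => [c|] // ->; rewrite orbF => /eqP ->.
  case/and5P=> h2 _ _ _ _; move: h2.
  by case: (g (3 * i).+1) => [[]|] /= => [->|->|->|_]; case: (g (3 * i)).
- rewrite (_ : (3 * i).+4 %% 3 = 1); last by lia.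
  case: (g (3 * i).+4) => [c|] // _; rewrite orbF => /eqP ->.
  move=> /and5P[_ h2 _ h3 _]; move: h2 h3; rewrite ?eqxx /=.
  by case: (g (3 * i).+2) => [[]|] /= => [->|->|->|_];
    case: (g (3 * i).+1) => [b|] /=; do ?move=> ->.
- rewrite (_ : (3 * i).+4.+1 %% 3 = 2); last by lia.
  case: (g (3 * i).+4.+1) => [c|] // _; rewrite orbF => /eqP ->.
  move=> /and5P[_ _ h2 _ /andP[h3 h4]]; move: h2 h3 h4; rewrite ?eqxx /=.
  by case: (g (3 * i).+3) => [b|] /= => [->|_]; case: (g (3 * i).+2) => [b'|] /=;
    do ?move=> ->.
Qed.
End Acceptance.

(** A match reduces, unlike the equality test of [color], which is transported
    from that of ordinals. *)
Definition has_colour (x : option color) (c : color) : bool :=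
  match x, c with
  | Some Plain, Plain | Some Underlined, Underlined
  | Some DoublyUnderlined, DoublyUnderlined => true
  | _, _ => false
  end.

Lemma has_colourP x c : reflect (x = Some c) (has_colour x c).
Proof. by apply: (iffP idP) => [|->]; [case: x => [[]|]; case: c | case: c]. Qed.

Definition apart (x y : option color) : bool :=
  if x is Some _ then if y is Some _ then false else true else true.

Lemma apartE x y : apart x y = (x == None) || (y == None).
Proof. by case: x => [x|]; case: y. Qed.

Definition period_bounds (x1 x2 x3 x4 x5 : option color) : bool :=
  let p x : nat := has_colour x Plain in
  let u x : nat := has_colour x Underlined in
  let d x : nat := has_colour x DoublyUnderlined in
  [&& [&& p x2 + p x3 + u x4 + p x5 <= 1, u x2 + u x3 + d x4 + u x5 <= 1
        & d x2 + u x3 + p x4 + d x5 <= 1],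
      [&& p x1 + u x2 + p x3 + p x4 <= 1, u x1 + d x2 + u x3 + u x4 <= 1
        & d x1 + p x2 + u x3 + d x4 <= 1]
    & (u x1 + p x3 + d x5 <= 2) && (d x1 + p x3 + u x5 <= 2)].

(** The tables [gap2_ok], [gap3_ok] and [triple_ok] forbid the pairs and triples of
    letters that violate one of the inequalities.  A doubly underlined part of
    degree 3i + 3 is excluded by hypothesis, because no inequality mentions it. *)
Lemma period_okE x1 x2 x3 x4 x5 :
  [&& apart x1 x2, apart x2 x3, apart x3 x4, apart x4 x5
    & ~~ has_colour x3 DoublyUnderlined] ->
  period_ok x1 x2 x3 x4 x5 = period_bounds x1 x2 x3 x4 x5.
Proof.
case: x1 => [[]|]; case: x2 => [[]|] //; case: x3 => [[]|] //;
  case: x4 => [[]|] //; by case: x5 => [[]|].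
Qed.

Definition represents (f : colored_partition) (g : nat -> option color) : Prop :=
  forall c r, mult f c r = has_colour (g r) c.

Definition conditions (f : colored_partition) : Prop :=
  (forall a, f a <= 1) /\ congruence_condition f /\ initial_condition f /\
  difference_condition f /\ four_term_condition f /\ three_term_condition f.

Lemma represents0 f g : represents f g -> g 0 = None.
Proof.
move=> fg; have m0 c : has_colour (g 0) c = false.
  by have := fg c 0; rewrite /mult insubF //; case: has_colour.
by case: (g 0) m0 => [[]|] // m0;
  [have := m0 Plain | have := m0 Underlined | have := m0 DoublyUnderlined].
Qed.

Lemma representsP f g : represents f g ->
  forall c (p : zpos), 0 < f ((c, p) : part) <-> g (val p) = Some c.
Proof.
move=> fg c p; rewrite -(Defs.multE f (c, p)) fg /degree /=.
by split=> [|->]; [case: has_colourP | case: c].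
Qed.

Lemma conditionsE f g : represents f g -> conditions f <-> admissible g.
Proof.
move=> fg; have g0 := represents0 fg; have fgP := representsP fg.
have pos r c : g r = Some c -> exists p : zpos, val p = r.
  by case: r => [|r]; [rewrite g0 | exists (Sub r.+1 isT)].
have f1 a : f a <= 1 by rewrite -Defs.multE fg leq_b1.
have bounds i : period_bounds (g (3 * i + 1)) (g (3 * i + 2)) (g (3 * i + 3))
    (g (3 * i + 4)) (g (3 * i + 5)) <->
  let p := mult f Plain in
  let u := mult f Underlined in
  let d := mult f DoublyUnderlined in
  ([/\ p (3 * i + 2) + p (3 * i + 3) + u (3 * i + 4) + p (3 * i + 5) <= 1,
      u (3 * i + 2) + u (3 * i + 3) + d (3 * i + 4) + u (3 * i + 5) <= 1
    & d (3 * i + 2) + u (3 * i + 3) + p (3 * i + 4) + d (3 * i + 5) <= 1] /\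
  [/\ p (3 * i + 1) + u (3 * i + 2) + p (3 * i + 3) + p (3 * i + 4) <= 1,
      u (3 * i + 1) + d (3 * i + 2) + u (3 * i + 3) + u (3 * i + 4) <= 1
    & d (3 * i + 1) + p (3 * i + 2) + u (3 * i + 3) + d (3 * i + 4) <= 1]) /\
   (u (3 * i + 1) + p (3 * i + 3) + d (3 * i + 5) <= 2 /\
    d (3 * i + 1) + p (3 * i + 3) + u (3 * i + 5) <= 2).
  rewrite /= !fg /period_bounds; split.
    by case/and3P=> /and3P[? ? ?] /and3P[? ? ?] /andP[? ?].
  by case=> -[[? ? ?] [? ? ?]] [? ?]; apply/and3P; split;
    [apply/and3P | apply/and3P | apply/andP].
have colour3 i : (forall r, if g r is Some c then colour_ok (r %% 3) c else true) ->
    ~~ has_colour (g (3 * i + 3)) DoublyUnderlined.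
  move/(_ (3 * i + 3)); rewrite (_ : (3 * i + 3) %% 3 = 0); last by lia.
  by case: (g _) => [[]|].
have adjacent i : (forall r, (g r == None) || (g r.+1 == None)) ->
    [&& apart (g (3 * i + 1)) (g (3 * i + 2)), apart (g (3 * i + 2)) (g (3 * i + 3)),
     apart (g (3 * i + 3)) (g (3 * i + 4)) & apart (g (3 * i + 4)) (g (3 * i + 5))].
  move=> adj; have e k : 3 * i + k.+1 = (3 * i + k).+1 by rewrite addnS.
  by rewrite !apartE (e 4) (e 3) (e 2) (e 1) !adj.
have colourE : congruence_condition f <->
    forall r, if g r is Some c then colour_ok (r %% 3) c else true.
  split=> [cg r|colok r /fgP gr].
    case E : (g r) => [c|] //; have [p pr] := pos _ _ E.
    rewrite -pr in E *; case: c E => E; try by case: (val p %% 3).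
    by have [->|->] := cg p (proj2 (fgP _ _) E).
  have := colok (val r); rewrite gr.
  by have := ltn_pmod (val r) (isT : 0 < 3); case: (val r %% 3) => [|[|[|]]] // _ _;
    [left | right].
have adjE : difference_condition f <-> forall r, (g r == None) || (g r.+1 == None).
  split=> [df r|adj [b p] [c s] bc].
    case E : (g r) => [b|] //; case E1 : (g r.+1) => [c|] //.
    have [p pr] := pos _ _ E; have [s sr] := pos _ _ E1.
    have ne : ((b, p) : part) <> (c, s) by case=> _ ps; move: sr; rewrite -ps pr; lia.
    have := df _ _ ne; rewrite /degree /= pr sr -[r.+1]addn1.
    rewrite -!Defs.multE !fg /degree /= pr sr E E1.
    have -> : has_colour (Some b) b by case: (b).
    have -> : has_colour (Some c) c by case: (c).
    by move=> H; apply: H; lia.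
  rewrite -!Defs.multE !fg /degree /=.
  case: has_colourP => // Ep; case: has_colourP => // Es; rewrite addn1 => dist.
  have [E|[E|E]] : val p = val s \/ val s = (val p).+1 \/ val p = (val s).+1.
    by move: dist; have [le|/ltnW le] := leqP (val p) (val s);
      rewrite ?(ssrint.IntDist.distnEr le) ?(ssrint.IntDist.distnEl le); move: le;
      move: (val p) (val s) => x y; lia.
  - case: bc; congr (_, _); last exact: val_inj.
    by move: Es; rewrite -E Ep => -[].
  - by have := adj (val p); rewrite -E Ep Es.
  - by have := adj (val s); rewrite -E Ep Es.
have initE : initial_condition f <->
    (g 1 = None \/ g 1 = Some DoublyUnderlined) /\ g 2 <> Some DoublyUnderlined.
  pose one : zpos := Sub 1 isT; pose two : zpos := Sub 2 isT.
  split=> [[ip iu id]|[g1 g2]].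
    split; last by move=> /(proj2 (fgP _ two)) /id.
    case E : (g 1) => [[]|]; auto.
    + by have /ip := proj2 (fgP _ one) E.
    + by have /iu := proj2 (fgP _ one) E.
  split=> r /fgP gr.
  - rewrite ltn_neqAle (valP r) andbT; apply/eqP => r1.
    by move: gr; rewrite -r1; case: g1 => ->.
  - rewrite ltn_neqAle (valP r) andbT; apply/eqP => r1.
    by move: gr; rewrite -r1; case: g1 => ->.
  - by move=> r2; move: gr; rewrite r2.
split=> [[_ [/colourE col [/initE[g1 g2] [/adjE adj [four three]]]]]|[col adj g1 g2 per]].
  split=> // i; rewrite period_okE; first by apply/bounds; split.
  by have /and4P[-> -> -> ->] := adjacent i adj; rewrite colour3.
have {per} both i : period_bounds (g (3 * i + 1)) (g (3 * i + 2)) (g (3 * i + 3))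
    (g (3 * i + 4)) (g (3 * i + 5)).
  by rewrite -period_okE ?per // colour3 // andbT; apply: adjacent.
split=> //; split; first exact/colourE; split; first exact/initE.
split; first exact/adjE.
by split=> p u d i; have [] := proj1 (bounds i) (both i).
Qed.

Definition colour_at (f : colored_partition) (r : nat) : option color :=
  if 0 < mult f Plain r then Some Plain
  else if 0 < mult f Underlined r then Some Underlined
  else if 0 < mult f DoublyUnderlined r then Some DoublyUnderlined
  else None.

(** The difference condition also applies to two colours of the same degree, hence
    each degree carries at most one part. *)
Lemma conditions_represents f : conditions f -> represents f (colour_at f).
Proof.
case=> f1 [_ [_ [df _]]] c r; rewrite /colour_at /mult.
case: insubP => [p _ pr|_]; last by case: c.
have one b b' : b <> b' -> f ((b, p) : part) + f ((b', p) : part) <= 1.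
  move=> ne; apply: df; first by case.
  by rewrite ssrint.IntDist.distnEl ?subnn.
have pu : f ((Plain, p) : part) + f ((Underlined, p) : part) <= 1 by apply: one.
have pd : f ((Plain, p) : part) + f ((DoublyUnderlined, p) : part) <= 1.
  exact: one.
have ud : f ((Underlined, p) : part) + f ((DoublyUnderlined, p) : part) <= 1.
  exact: one.
case: c; move: pu pd ud (f1 ((Plain, p) : part)) (f1 ((Underlined, p) : part))
  (f1 ((DoublyUnderlined, p) : part));
  by case: (f (Plain, p)) => [|[|x]]; case: (f (Underlined, p)) => [|[|y]];
     case: (f (DoublyUnderlined, p)) => [|[|z]].
Qed.

(** * The identity *)

Definition start : window := Window None None (Some DoublyUnderlined) None.

Definition coloured_words (n : nat) : seq (seq (option color)) :=
  words letters letter_ok slide n 1 start.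

Lemma uniq_colours : uniq [:: Plain; Underlined; DoublyUnderlined].
Proof. by rewrite /= !inE !negb_or; do ?[apply/andP; split=> //]; apply/eqP. Qed.

Lemma uniq_letters : uniq letters.
Proof.
rewrite -[letters]/(None :: map Some [:: Plain; Underlined; DoublyUnderlined]).
rewrite cons_uniq map_inj_uniq ?uniq_colours ?andbT; last by move=> x y [].
by apply/mapP => -[].
Qed.

Lemma mem_colours c : c \in [:: Plain; Underlined; DoublyUnderlined].
Proof. by case: c; rewrite !inE eqxx ?orbT. Qed.

Lemma mem_coloured_words n g : g 0 = None ->
  (forall r, n < r -> g r = None) ->
  [seq g i | i <- iota 1 n] \in coloured_words n <-> admissible g.
Proof.
move=> g0 gbig; rewrite mem_words size_map size_iota eqxx /=.
have -> : all (mem letters) [seq g i | i <- iota 1 n].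
  by apply/allP => -[[]|] _; rewrite /= !inE eqxx ?orbT.
have -> : start = window_at g 1 by rewrite /start /window_at /= g0.
rewrite accepted_map //=.
rewrite -admissibleE //; split=> [/allP ok r r0|ok]; last first.
  by apply/allP => r; rewrite mem_iota => /andP[r0 _]; apply: ok.
have [ltnr|lern] := ltnP n r; first by rewrite gbig.
by apply: ok; rewrite mem_iota r0 add1n ltnS.
Qed.

Definition parts_upto (n : nat) : seq part :=
  [seq ((c, p) : part)
     | c <- [:: Plain; Underlined; DoublyUnderlined], p <- zpos_upto n].

Lemma mem_parts_upto n (a : part) : (a \in parts_upto n) = (degree a <= n).
Proof.
case: a => c p; rewrite /degree /= -mem_zpos_upto.
by apply/allpairsP/idP => [[[d s] [_ ps [_ ->]]] // | pn];
  exists (c, p); split=> //; exact: mem_colours.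
Qed.

Lemma uniq_parts_upto n : uniq (parts_upto n).
Proof.
by apply: allpairs_uniq; rewrite ?uniq_zpos_upto ?uniq_colours // => -[c p] [].
Qed.

Lemma has_colour_sum x :
  has_colour x Plain + has_colour x Underlined + has_colour x DoublyUnderlined
  = present x.
Proof. by case: x => [[]|]. Qed.

Lemma weight_represents n f g : represents f g ->
  (forall a : part, f a != 0 -> degree a <= n) ->
  weight degree f = word_weight present 1 [seq g i | i <- iota 1 n].
Proof.
move=> fg supp; rewrite (weight_seq _ (uniq_parts_upto n)); last first.
  by move=> a /supp; rewrite mem_parts_upto.
rewrite word_weight_map -sum_zpos_upto big_allpairs !big_cons big_nil /= addn0.
rewrite -!big_split /=; apply: eq_bigr => p _.
by rewrite -!Defs.multE !fg /degree /= -has_colour_sum; lia.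
Qed.

Lemma card_coloured n :
  #|` fset_set [set f : colored_partition |
        colored_partitions_of n f /\
        (forall a, f a <= 1) /\
        congruence_condition f /\
        initial_condition f /\
        difference_condition f /\
        four_term_condition f /\
        three_term_condition f]%classic |
  = size [seq w <- coloured_words n | word_weight present 1 w == n].
Proof.
have supp (f : colored_partition) : colored_partitions_of n f ->
    forall a : part, f a != 0 -> degree a <= n.
  move=> <- a fa; apply: leq_trans (weight_ge _ f a).
  by rewrite leq_pmulr ?lt0n.
have big (f : colored_partition) : colored_partitions_of n f ->
    represents f (colour_at f) -> forall r, n < r -> colour_at f r = None.
  move=> fn rep r ltnr; case E : (colour_at f r) => [c|] //.
  have r0 : 0 < r by apply: leq_ltn_trans ltnr.
  have := proj2 (representsP rep c (Sub r r0)) E; rewrite lt0n => /(supp _ fn).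
  by rewrite /degree /= leqNgt ltnr.
apply: (@card_fset_set_code _ _ _ _ (fun f => [seq colour_at f i | i <- iota 1 n])).
- by apply: sub_finite_set (finite_colored_partitions_of n) => f [].
- by rewrite filter_uniq // uniq_words // uniq_letters.
- move=> f [fn cond]; have rep := conditions_represents cond.
  rewrite mem_filter -(weight_represents rep (supp _ fn)) fn eqxx /=.
  apply/mem_coloured_words; [exact: represents0 rep | exact: big |].
  exact/(conditionsE rep).
- move=> f g [fn /conditions_represents fr] [gn /conditions_represents gr] /eq_in_map fg.
  apply/fsfunP => -[c p]; have [pn|pn] := leqP (val p) n; last first.
    have zero (h : colored_partition) : colored_partitions_of n h ->
        h ((c, p) : part) = 0.
      by move=> /supp hn; apply/eqP/negPn/negP => /hn; rewrite leqNgt pn.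
    by rewrite !zero.
  rewrite -!(Defs.multE _ ((c, p) : part)) fr gr /= fg // mem_iota (valP p).
  by rewrite add1n ltnS.
move=> w; rewrite mem_filter => /andP[/eqP ww wW].
have sw : size w = n by move: wW; rewrite mem_words => /and3P[/eqP].
pose g := nth None (None :: w).
have gw : [seq g i | i <- iota 1 n] = w.
  apply: (@eq_from_nth _ None); rewrite size_map size_iota // => i ltin.
  by rewrite (nth_map 0) ?size_iota // nth_iota.
have gbig r : n < r -> g r = None.
  by move=> ltnr; rewrite /g nth_default //= sw.
pose f : colored_partition :=
  [fsfun a in [fset a in parts_upto n]%fset => has_colour (g (degree a)) a.1 : nat | 0].
have fE a : f a = has_colour (g (degree a)) a.1.
  rewrite fsfun_fun in_fset /= mem_parts_upto.
  by case: leqP => // ltna; rewrite gbig.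
have rep : represents f g.
  by move=> c [|r]; rewrite /mult; [rewrite insubF | rewrite insubT fE].
have fs a : f a != 0 -> degree a <= n.
  by rewrite fE leqNgt; apply: contra => /gbig ->.
have fn : colored_partitions_of n f.
  by rewrite /colored_partitions_of /= (weight_represents rep fs) gw.
have cond : conditions f.
  apply/(conditionsE rep)/(mem_coloured_words _ gbig); rewrite ?gw //.
exists f; first by split.
rewrite -gw; apply/eq_in_map => i _.
have E c : has_colour (colour_at f i) c = has_colour (g i) c.
  have := rep c i; rewrite (conditions_represents cond).
  by case: has_colour; case: has_colour.
move: (E Plain) (E Underlined) (E DoublyUnderlined).
by case: (colour_at f i) => [[]|]; case: (g i) => [[]|].
Qed.

(** Words of length n have their last letter in degree n, hence M = n + 1. *)
Lemma size_coloured_words n :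
  size [seq w <- coloured_words n | word_weight present 1 w == n]
  = size [seq w <- frequency_words n | word_weight id 1 w == n].
Proof.
apply/eqP; rewrite -(Num.Theory.eqr_nat int); apply/eqP.
rewrite size_frequency_words -coef_series.
set q := ('qX)%R; have qn0 : (q ^+ n.+1 = 0)%R := qX_nilpotent n.
congr (((_ : {poly %/ ('X^(n.+1) : {poly int})%R}) : {poly int})`_n)%R.
rewrite -(closed_form0 qn0) -(z_seriesE qn0).
(* The degree -1 is 2 modulo 3, hence the colour of the part in that degree is
   irrelevant. *)
have := colour_ruleP qn0 0 None None DoublyUnderlined; rewrite /= => <-.
rewrite /after (completions_step qn0) /push_part /letter_ok /guard /= !addr0.
by rewrite /completions subSS subn0.
Qed.

Theorem theoremB (n : nat) :
  #|` fset_set [set f : one_color_partition |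
        one_color_partitions_of n f /\ (forall a, f a <= 2)]%classic |
  =
  #|` fset_set [set f : colored_partition |
        colored_partitions_of n f /\
        (forall a, f a <= 1) /\
        congruence_condition f /\
        initial_condition f /\
        difference_condition f /\
        four_term_condition f /\
        three_term_condition f]%classic |.
Proof. by rewrite card_one_colour card_coloured size_coloured_words. Qed.
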